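(* Let $(X,d)$ be a compact metric space and $f_{0,\infty}=\{f_n\}_{n=0}^\infty$ a sequence of continuous self-maps of $X$ with $f_0$ surjective. If $(X,f_{0,\infty})$ is multi-sensitive, then there exists $A\in\mathcal{S}$ such that $h^{*}(f_{0,\infty})\geq h_{A}(f_{0,\infty})\geq\log 2$, and $h_A(\hat{f}_{0,\infty})=h^{*}(\hat{f}_{0,\infty})=+\infty$.
   Context: $f_0^n=f_{n-1}\circ\cdots\circ f_0$, $f_0^0=\mathrm{id}$. $(X,f_{0,\infty})$ is multi-sensitive if there is $\delta>0$ such that for every $k\ge1$ and nonempty open $V_1,\dots,V_k\subset X$ there is $n\ge1$ with $\mathrm{diam}(f_0^n(V_i))>\delta$ for all $1\le i\le k$. $\mathcal S$ is the set of strictly increasing sequences $A=\{a_i\}_{i\ge1}$ of nonnegative integers. For a compact metric space $Z$ and continuous self-maps $g_{0,\infty}$, $h_A(g_{0,\infty})=\sup_{\mathscr A}\limsup_{n\to\infty}\frac1n\log\mathcal N(\bigvee_{i=1}^n (g_0^{a_i})^{-1}\mathscr A)$ over finite open covers ($\bigvee$ = common refinement, $\mathcal N$ = minimal cardinality of a subcover), $\log$ natural, and $h^*(g_{0,\infty})=\sup_{A\in\mathcal S}h_A(g_{0,\infty})$. $\mathcal M(X)$ is the space of Borel probability measures with the weak$^*$ topology (compact metric, e.g. via the Prohorov metric), and $\hat f_n(\mu)(B)=\mu(f_n^{-1}(B))$. *)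

(* Defs.v *)
From HB Require Import structures.
From mathcomp Require Import all_boot all_order all_algebra.
From mathcomp Require Import all_classical all_reals all_analysis.

Set Implicit Arguments.
Unset Strict Implicit.
Unset Printing Implicit Defensive.

Import Order.TTheory GRing.Theory Num.Theory.
Import numFieldTopology.Exports numFieldNormedType.Exports.
Local Open Scope classical_set_scope.
Local Open Scope ring_scope.

#[short(type="pmetricType")]
HB.structure Definition PointedMetric (K : numDomainType) :=
  { M of Pointed M & Metric K M }.

Fixpoint compn {Z : Type} (g : nat -> Z -> Z) (n : nat) : Z -> Z :=
  match n with
  | 0 => id
  | n'.+1 => g n' \o compn g n'
  end.

(* Minimal cardinality of a subfamily of the finite family F covering Z
   (#|I| if F itself does not cover). *)
Definition Ncov {Z : Type} {I : finType} (F : I -> set Z) : nat :=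
  \big[minn/#|I|]_(S : {set I} | `[< [set: Z] `<=` \bigcup_(i in [set i | i \in S]) F i >])
     #|S|.

(* The common refinement  \/_{i=1}^n (g_0^{a_i})^{-1} U  of the finite cover
   U : 'I_k -> set Z ; here the sequence A = {a_i}_{i>=1} is coded by
   a : nat -> nat with a_{i+1} = a i. Its members are indexed by choices
   j : 'I_n -> 'I_k. *)
Definition join_cover {Z : Type} (g : nat -> Z -> Z) (a : nat -> nat)
  (k : nat) (U : 'I_k -> set Z) (n : nat) : {ffun 'I_n -> 'I_k} -> set Z :=
  fun j => \bigcap_(i in [set: 'I_n]) (compn g (a i) @^-1` U (j i)).
Arguments join_cover {Z} g a {k} U n.

Definition open_cover {Z : topologicalType} (k : nat) (U : 'I_k -> set Z) : Prop :=
  (forall i, open (U i)) /\ [set: Z] `<=` \bigcup_(i in [set: 'I_k]) U i.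

Definition seq_entropy {R : realType} {Z : topologicalType}
  (g : nat -> Z -> Z) (a : nat -> nat) : \bar R :=
  ereal_sup [set r | exists (k : nat) (U : 'I_k -> set Z), open_cover U /\
     r = limn_esup
           (fun n => ((ln ((Ncov (join_cover g a U n))%:R : R)) / n%:R)%:E)].

Definition strictly_increasing (a : nat -> nat) : Prop :=
  forall i j, (i < j)%N -> (a i < a j)%N.

Definition hstar {R : realType} {Z : topologicalType} (g : nat -> Z -> Z) : \bar R :=
  ereal_sup [set seq_entropy (R := R) g a | a in strictly_increasing].

Definition ediam {R : realType} {X : pmetricType R} (S : set X) : \bar R :=
  ereal_sup [set (mdist p.1 p.2)%:E | p in S `*` S].

Definition multi_sensitive {R : realType} {X : pmetricType R} (f : nat -> X -> X) : Prop :=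
  exists2 delta : R, 0 < delta &
    forall (k : nat) (V : 'I_k -> set X), (0 < k)%N ->
      (forall i, open (V i) /\ V i !=set0) ->
      exists2 n : nat, (1 <= n)%N &
        forall i, (delta%:E < ediam (compn f n @` V i))%E.

Definition borel (X : ptopologicalType) := g_sigma_algebraType (@open X).

Definition PM (R : realType) (X : ptopologicalType) := probability (borel X) R.

Definition CX (R : realType) (X : ptopologicalType) := {g : X -> R | continuous g}.

Definition integrals (R : realType) (X : ptopologicalType) (mu : PM R X) :
  {ptws CX R X -> \bar R} :=
  fun g => (\int[mu]_x (proj1_sig g x)%:E)%E.

(* M(X) with the weak* topology: the initial topology making all maps
   mu |-> \int g dmu (g continuous) continuous *)
Definition Mspace (R : realType) (X : ptopologicalType) : topologicalType :=
  initial_topology (@integrals R X).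

Definition mk_mfun d d' (T : measurableType d) (U : measurableType d')
  (f : T -> U) (mf : measurable_fun [set: T] f) : {mfun T >-> U} :=
  HB.pack f (isMeasurableFun.Build _ _ _ _ f mf).

(* induced map \hat f (mu) = mu o f^{-1} (pushforward); for a non-Borel-
   measurable f (never the case for continuous f) it is set to the identity *)
Definition hat (R : realType) (X : ptopologicalType) (f : X -> X) :
  Mspace R X -> Mspace R X :=
  fun mu : PM R X =>
    match pselect (measurable_fun [set: borel X] (f : borel X -> borel X)) with
    | left mf => (distribution mu (mk_mfun mf) : PM R X)
    | right _ => mu
    end.

Definition hatseq (R : realType) (X : ptopologicalType) (f : nat -> X -> X) :
  nat -> Mspace R X -> Mspace R X := fun n => @hat R X (f n).

(* Main.v *)
(** Multi-sensitivity lets one split finitely many open sets at one common time, so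
    it produces times [a_0 < a_1 < ...] and a binary tree of open sets in which the
    two children of each node of level [n] are [delta]-apart after time [a_n].
    Hence the [2^n] words of length [n] give [2^n] points pairwise [delta]-separated
    along [a], and h_A(f) >= log 2.

    For M(X), send a [k]-tuple of such points to the atomic measure with weights
    proportional to [4^l]. If two tuples differ, let [i] be the largest index where
    they do: the atoms above [i] cancel, and those below [i] cannot compensate the
    [i]-th one, so a truncated distance to a point of a finite net has well separated
    integrals at one of the times [a_m]. This gives [2^(kn)] separated measures, hence
    h_A >= k log 2 for every [k]. Separation is always detected by finitely many
    bounded continuous functions, so the open covers are pulled back from boxes and
    the compactness of M(X) is never needed. *)
Require Import Defs.
From HB Require Import structures.
From mathcomp Require Import all_boot all_order all_algebra.
From mathcomp Require Import all_classical all_reals all_analysis.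
From mathcomp Require Import measurable_realfun ring lra.

Set Implicit Arguments.
Unset Strict Implicit.
Unset Printing Implicit Defensive.

Import Order.TTheory GRing.Theory Num.Theory.
Import numFieldTopology.Exports numFieldNormedType.Exports.
Local Open Scope classical_set_scope.
Local Open Scope ring_scope.

(** * Separated points and lower bounds for the entropy *)

(** Sending each point to a member of the subcover that contains it is injective, because no member
    contains two of the points. *)
Lemma leq_Ncov_separated (Z : Type) (I T : finType) (F : I -> set Z) (p : T -> Z) :
  [set: Z] `<=` \bigcup_i F i ->
  (forall i s t, F i (p s) -> F i (p t) -> s = t) -> (#|T| <= Ncov F)%N.
Proof.
move=> Fcov Fsep.
have card_cover (S : {set I}) :
    [set: Z] `<=` \bigcup_(i in [set i | i \in S]) F i -> (#|T| <= #|S|)%N.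
  move=> Scov.
  have /choice[h hP] : forall t, exists i, i \in S /\ F i (p t).
    by move=> t; have [i iS Fi] := Scov (p t) Logic.I; exists i.
  have hinj : injective h.
    move=> s t st; have [[_ hs] [_ ht]] := (hP s, hP t).
    by apply: (Fsep (h s) s t) => //; rewrite st.
  rewrite -(card_imset predT hinj); apply/subset_leq_card/fintype.subsetP => i.
  by case/imsetP => t _ ->; have [] := hP t.
rewrite /Ncov; apply: (big_ind (fun m => #|T| <= m)%N) => [|m n Tm Tn|S /asboolP].
(* The minimum starts from the default [#|I|], which is the size of the whole family, itself a
   cover. *)
- rewrite -[leqRHS]cardsT; apply: card_cover => z /Fcov[i _ Fi].
  by exists i => //=; rewrite inE.
- by rewrite leq_min Tm Tn.
- exact: card_cover.
Qed.

Lemma limn_esup_ge (R : realType) (u : nat -> \bar R) (c : \bar R) :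
  (forall n, (0 < n)%N -> (c <= u n)%E) -> (c <= limn_esup u)%E.
Proof.
move=> cu; apply: le_ereal_inf_tmp => _ [V [n _ nV] <-].
apply: (le_trans (cu n.+1 isT)); apply: ereal_sup_ubound.
by exists n.+1 => //; apply: nV => /=.
Qed.

(** The functions [phi j] act as finitely many bounded coordinates; boxes of side [e] in them form a
    finite open cover no member of which contains two points that some coordinate sets [e] apart. *)
Lemma seq_entropy_ge_separated (R : realType) (Z : topologicalType)
    (g : nat -> Z -> Z) (a : nat -> nat) (J : finType) (phi : J -> Z -> R)
    (D e c : R) :
  0 < e -> (forall j z, 0 <= phi j z <= D) ->
  (forall j x y, open [set z | x < phi j z < y]) ->
  (forall n, (0 < n)%N -> exists (T : finType) (p : T -> Z),
    c * n%:R <= ln #|T|%:R /\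
    forall s t, s != t -> exists (i : 'I_n) (j : J),
      e <= `|phi j (compn g (a i) (p s)) - phi j (compn g (a i) (p t))|) ->
  (c%:E <= seq_entropy (R := R) g a)%E.
Proof.
move=> e0 phiD ophi sep.
(* Intervals of centre [h * q] and radius [h] have length [e]; the [N] centres with [q <= D / h]
   suffice for [[0, D]]. *)
pose h := e / 2; have h0 : 0 < h by rewrite /h; lra.
pose N := (Num.truncn (D / h)).+1.
pose B (q : {ffun J -> 'I_N}) : set Z := \bigcap_(j in [set: J])
  [set z | h * ((q j)%:R - 1) < phi j z < h * ((q j)%:R + 1)].
pose k := #|{ffun J -> 'I_N}|.
pose U (i : 'I_k) := B (enum_val i).
have ocU : open_cover U.
  split=> [i|z _].
    rewrite openE => z Bz.
    suff : \forall w \near z, forall j : J,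
        [set w | h * ((enum_val i j)%:R - 1) < phi j w
                 < h * ((enum_val i j)%:R + 1)] w.
      by apply: filterS => w Bw j _; exact: Bw.
    apply: filter_forall => j; apply: open_nbhs_nbhs.
    by split; [exact: ophi|exact: Bz].
  have phij j : 0 <= phi j z / h <= D / h.
    have /andP[z0 zD] := phiD j z.
    by rewrite divr_ge0 ?(ltW h0)//= ler_pM2r// invr_gt0.
  have ltN j : (Num.truncn (phi j z / h) < N)%N.
    by rewrite /N ltnS; have /andP[_ ?] := phij j; exact: le_truncn.
  (* Rounding [phi j z / h] down gives [h * q <= phi j z < h * (q + 1)], inside the open interval
     centred at [h * q]. *)
  exists (enum_rank [ffun j => Ordinal (ltN j)]) => //.
  rewrite /U enum_rankK => j _; rewrite /= ffunE /=.
  have /andP[z0 _] := phij j; have /andP[lo hi] := truncn_itv z0.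
  rewrite ler_pdivlMr// in lo; rewrite ltr_pdivrMr// -natr1 in hi.
  by apply/andP; split; nra.
have Usep i z w j : U i z -> U i w -> `|phi j z - phi j w| < e.
  move=> /(_ j Logic.I)/= /andP[z1 z2] /(_ j Logic.I)/= /andP[w1 w2].
  have -> : e = h * 2 by rewrite /h; lra.
  by rewrite ltr_norml; apply/andP; split; nra.
apply: (@le_trans _ _ (limn_esup
  (fun n => (ln ((Ncov (join_cover g a U n))%:R : R) / n%:R)%:E))); last first.
  by apply: ereal_sup_ubound; exists k, U.
apply: limn_esup_ge => n n0; have [T [p [cT Tsep]]] := sep n n0.
rewrite lee_fin ler_pdivlMr ?ltr0n//; apply: (le_trans cT).
have TN : (#|T| <= Ncov (join_cover g a U n))%N.
  apply: (@leq_Ncov_separated _ _ _ (join_cover g a U n) p) => [z _|q s t qs qt].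
    have /choice[w wP] : forall i : 'I_n, exists l, U l (compn g (a i) z).
      move=> i; case: ocU => _ /(_ (compn g (a i) z) Logic.I)[l _ Ul].
      by exists l.
    by exists [ffun i => w i] => // i _; rewrite /= ffunE.
  apply/eqP/negPn/negP => /Tsep[i [j]]; apply/negP; rewrite -ltNge.
  exact: Usep (qs i Logic.I) (qt i Logic.I).
(* If [T] is empty, the left side is [ln 0 = 0] by convention, and the logarithm of a natural number
   is nonnegative. *)
have [T0|T0] := posnP #|T|; last first.
  by rewrite ler_ln ?posrE ?ltr0n ?ler_nat// (leq_trans T0).
rewrite T0 (ln0 (lexx _)); case: (Ncov _) => [|m]; first by rewrite ln0.
by rewrite ln_ge0// ler1n.
Qed.

(** * The binary tree of open sets and its separated words *)

Lemma compn_continuous (Z : topologicalType) (g : nat -> Z -> Z) (n : nat) :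
  (forall m, continuous (g m)) -> continuous (compn g n).
Proof.
move=> cg; elim: n => [|n IHn] x; first exact: cvg_id.
by apply: continuous_comp; [exact: IHn|exact: cg].
Qed.

Section SeparatedTree.
Variables (R : realType) (X : pmetricType R) (F : nat -> X -> X) (delta : R).
Hypothesis F_continuous : forall n, continuous (F n).
Hypothesis delta_gt0 : 0 < delta.
Hypothesis F_sensitive : forall (T : finType) (V : T -> set X), (0 < #|T|)%N ->
  (forall t, open (V t) /\ V t !=set0) ->
  exists n, forall t, exists x y,
    [/\ V t x, V t y & delta < mdist (F n x) (F n y)].

Lemma nbhs_preimage_ball n x e : 0 < e -> nbhs x [set y | mdist (F n x) (F n y) < e].
Proof.
move=> e0; suff -> : [set y | mdist (F n x) (F n y) < e] = F n @^-1` ball (F n x) e.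
  by apply: F_continuous; exact: nbhsx_ballx.
by rewrite ballEmdist.
Qed.

(** Uses continuity of the finitely many maps [F 0], ..., [F N]. A time that separates two points of
    [W] by [delta] must exceed [N], which is what makes the times increase. *)
Lemma open_shrink (V : set X) (N : nat) : open V -> V !=set0 ->
  exists W, [/\ open W, W !=set0, W `<=` V &
    forall n x y, (n <= N)%N -> W x -> W y -> mdist (F n x) (F n y) < delta].
Proof.
move=> oV [x Vx].
have : nbhs x (V `&` [set y | forall n : 'I_N.+1,
    mdist (F n x) (F n y) < delta / 2]).
  apply: filterI; first exact: open_nbhs_nbhs.
  have dh : 0 < delta / 2 by rewrite divr_gt0.
  by apply: filter_forall => n; exact: nbhs_preimage_ball.
rewrite nbhsE => -[W [oW Wx] WV]; exists W; split => //.
- by exists x.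
- by move=> y /WV[].
- move=> n y z nN /WV[_ /(_ (Ordinal (nN : n < N.+1)%N))/= xy].
  move=> /WV[_ /(_ (Ordinal (nN : n < N.+1)%N))/= xz].
  have := metric_triangle (F n y) (F n x) (F n z).
  by rewrite (metric_sym (F n y) (F n x)); lra.
Qed.

Lemma sensitive_split (T : finType) (V : T -> set X) (N : nat) : (0 < #|T|)%N ->
  (forall t, open (V t) /\ V t !=set0) ->
  exists n (W : T -> bool -> set X), [/\ (N < n)%N,
    forall t b, [/\ open (W t b), W t b !=set0 & W t b `<=` V t] &
    forall t x y, W t true x -> W t false y -> delta < mdist (F n x) (F n y)].
Proof.
move=> T0 oV.
have /choice[V' V'P] : forall t, exists W, [/\ open W, W !=set0, W `<=` V t &
    forall n x y, (n <= N)%N -> W x -> W y -> mdist (F n x) (F n y) < delta].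
  by move=> t; have [oVt Vt0] := oV t; exact: open_shrink.
have [|n nP] := @F_sensitive T V' T0; first by move=> t; have [] := V'P t.
have Nn : (N < n)%N.
  rewrite ltnNge; apply/negP => nN; have /card_gt0P[t _] := T0.
  have [x [y [V'x V'y]]] := nP t; have [_ _ _ /(_ n x y nN V'x V'y)] := V'P t.
  by lra.
have /choice[W WP] : forall t, exists W : bool -> set X,
    (forall b, [/\ open (W b), W b !=set0 & W b `<=` V t]) /\
    (forall x y, W true x -> W false y -> delta < mdist (F n x) (F n y)).
  move=> t; have [x [y [V'x V'y xy]]] := nP t; have [oV' _ V'V _] := V'P t.
  (* Half of the excess over [delta]: moving both images by less than [e] keeps them more than
     [delta] apart. *)
  pose e := (mdist (F n x) (F n y) - delta) / 2.
  have e0 : 0 < e by rewrite /e; lra.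
  have nb z : V' t z -> exists B, [/\ open B, B z, B `<=` V t &
      forall w, B w -> mdist (F n z) (F n w) < e].
    move=> V'z; have : nbhs z (V' t `&` [set w | mdist (F n z) (F n w) < e]).
      apply: filterI; first exact: open_nbhs_nbhs.
      exact: nbhs_preimage_ball.
    rewrite nbhsE => -[B [oB Bz] BV]; exists B; split => // w /BV[]//.
    by move=> /V'V.
  have [A [oA Ax AV Ae]] := nb x V'x; have [B [oB By BV Be]] := nb y V'y.
  exists (fun b => if b then A else B); split.
    by case; split => //; [exists x|exists y].
  move=> u v /Ae xu /Be yv.
  have := metric_triangle (F n x) (F n u) (F n y).
  have := metric_triangle (F n u) (F n v) (F n y).
  rewrite (metric_sym (F n v) (F n y)); move: xu yv; rewrite /e; lra.
exists n, W; split => // t; [|exact: (WP t).2].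
by move=> b; exact: (WP t).1.
Qed.

Lemma separated_words : exists a : nat -> nat, strictly_increasing a /\
  forall n, exists x : n.-tuple bool -> X, forall s t, s != t ->
    exists i : 'I_n, delta < mdist (F (a i) (x s)) (F (a i) (x t)).
Proof.
pose inv n (V : seq bool -> set X) :=
  forall w, size w = n -> open (V w) /\ V w !=set0.
(* a state [(N, V)] consists of the last time and of the open sets [V w] attached to
   the words [w] of the current length; new letters are put in front *)
pose next n (p q : nat * (seq bool -> set X)) :=
  [/\ (p.1 < q.1)%N, inv n.+1 q.2,
      forall b w, size w = n -> q.2 (b :: w) `<=` p.2 w &
      forall w x y, size w = n -> q.2 (true :: w) x -> q.2 (false :: w) y ->
        delta < mdist (F q.1 x) (F q.1 y)].
have /choice[S SP] : forall np : nat * (nat * (seq bool -> set X)),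
    exists q, inv np.1 np.2.2 -> next np.1 np.2 q.
  (* The choice function is total, so a state violating the invariant receives a dummy successor. *)
  move=> [n [N V]] /=; have [iV|niV] := pselect (inv n V); last by exists (N, V).
  have [||m [W [Nm WP Wsep]]] :=
    @sensitive_split {:n.-tuple bool} (fun t => V t) N.
  - by rewrite card_tuple expn_gt0 card_bool.
  - by move=> t; apply: iV; rewrite size_tuple.
  exists (m, fun w => if w is b :: u then
    if insub u is Some t then W t b else set0 else set0) => _.
  split => //=.
  - case=> [//|b u [un]]; rewrite insubT; first by apply/eqP.
    by move=> un'; case: (WP (Sub u un') b).
  - move=> b w wn; rewrite insubT; first by apply/eqP.
    by move=> wn'; case: (WP (Sub w wn') b).
  - move=> w x y wn; rewrite insubT; first by apply/eqP.
    by move=> wn'; exact: Wsep.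
pose fix st n := if n is n'.+1 then S (n', st n') else (0%N, fun=> [set: X]).
have stinv n : inv n (st n).2.
  elim: n => [|n IHn]; last by have [] := SP (n, st n) IHn.
  by move=> w _; split; [exact: openT|exists point].
have stP n : next n (st n) (st n.+1) by exact: SP (n, st n) (stinv n).
(* Distinct words share a suffix up to the level where they branch. They are separated at the time
   of that level, and inclusion passes this on to all descendants. *)
have sep n w w' : size w = n -> size w' = n -> w != w' ->
    forall x y, (st n).2 w x -> (st n).2 w' y ->
    exists2 i, (i < n)%N & delta < mdist (F (st i.+1).1 x) (F (st i.+1).1 y).
  elim: n w w' => [|n IHn] [|b w] [|b' w']// [wn] [wn'] ne x y stx sty.
  have [_ _ sub dist] := stP n.
  have [ww'|ww'] := eqVneq w w'; last first.
    have [i ilt id] := IHn w w' wn wn' ww' x y (sub _ _ wn _ stx) (sub _ _ wn' _ sty).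
    by exists i => //; exact: ltnW.
  exists n => //; move: ne stx sty; rewrite -{w' wn'}ww'.
  case: b b' => [] []; rewrite ?eqxx// => _ stx sty.
    exact: dist stx sty.
  by rewrite metric_sym; exact: dist sty stx.
(* The split of level [n] happens at the time stored in state [n.+1]; the time of state [0] is only
   a starting bound. *)
exists (fun n => (st n.+1).1); split.
  move=> i j; apply: (homo_ltn (f := fun n => (st n.+1).1) ltn_trans) => {}i.
  by case: (stP i.+1).
move=> n; have /choice[x xP] : forall t : n.-tuple bool, exists x, (st n).2 t x.
  by move=> t; have [] := stinv n t (size_tuple t).
exists x => s t st_ne.
have [i ilt id] := sep n s t (size_tuple s) (size_tuple t) st_ne _ _ (xP s) (xP t).
by exists (Ordinal ilt).
Qed.

End SeparatedTree.

Lemma multi_sensitive_finType (R : realType) (X : pmetricType R) (f : nat -> X -> X) :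
  multi_sensitive f -> exists2 delta : R, 0 < delta &
  forall (T : finType) (V : T -> set X), (0 < #|T|)%N ->
  (forall t, open (V t) /\ V t !=set0) ->
  exists n, forall t, exists x y,
    [/\ V t x, V t y & delta < mdist (compn f n x) (compn f n y)].
Proof.
move=> [delta delta0 sens]; exists delta => // T V T0 oV.
have [||n _ nP] := sens #|T| (fun i => V (enum_val i)) => //.
exists n => t; have := nP (enum_rank t); rewrite enum_rankK /ediam.
move/ereal_sup_gt => [_ [[_ _] [[x Vx <-] [y Vy <-]] <-]] /=; rewrite lte_fin.
by exists x, y.
Qed.

(** * Truncated distances to a finite net *)

Section TruncatedDistance.
Variables (R : realType) (X : pmetricType R) (delta : R).
Hypothesis delta_gt0 : 0 < delta.

(** Truncation confines the values to [[0, delta]], so the gap [delta / 2] obtained below is a fixed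
    fraction of the range; the weights [4 ^+ l] rely on this ratio. *)
Definition tdist (z x : X) : R := Num.min (mdist z x) delta.

Lemma tdist_ge0 z x : 0 <= tdist z x.
Proof. by rewrite le_min mdist_ge0 ltW. Qed.

Lemma tdist_le z x : tdist z x <= delta.
Proof. by rewrite ge_min lexx orbT. Qed.

Lemma tdist_lipschitz z x y : `|tdist z x - tdist z y| <= mdist x y.
Proof.
have xy := metric_triangle z x y; have yx := metric_triangle z y x.
rewrite (metric_sym y x) in yx.
rewrite ler_norml /tdist.
case: (leP (mdist z x) delta) => ?; case: (leP (mdist z y) delta) => ?;
  by apply/andP; split; lra.
Qed.

Lemma tdist_continuous z : continuous (tdist z).
Proof.
move=> x; apply/cvgrPdist_lt => e e0.
have := nbhsx_ballx x e e0; rewrite ballEmdist; apply: filterS => y /=.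
exact: le_lt_trans (tdist_lipschitz _ _ _).
Qed.

(** A net point within [delta / 4] of [x] is more than [3 * delta / 4] away from [y], and truncation
    at [delta] preserves this. *)
Lemma tdist_separates (J : finType) (z : J -> X) :
  (forall x, exists j, mdist (z j) x < delta / 4) ->
  forall x y, delta < mdist x y ->
    exists j, delta / 2 <= `|tdist (z j) x - tdist (z j) y|.
Proof.
move=> zP x y xy; have [j zx] := zP x; exists j.
have := metric_triangle x (z j) y; rewrite (metric_sym x (z j)) => tri.
rewrite ler_normr /tdist; apply/orP; right.
case: (leP (mdist (z j) x) delta) => ?; case: (leP (mdist (z j) y) delta) => ?;
  by lra.
Qed.

Lemma compact_finite_net (e : R) : compact [set: X] -> 0 < e ->
  exists (J : finType) (z : J -> X), forall x, exists j, mdist (z j) x < e.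
Proof.
rewrite compact_cover => cX e0.
have [||D _ DX] := cX X setT (fun z => (ball z e)^°).
- by move=> z _; exact: open_interior.
- by move=> x _; exists x => //; exact: nbhsx_ballx.
exists 'I_(size (finmap.enum_fset D)).
exists (fun i : 'I_(_) => nth point (finmap.enum_fset D) i) => x.
have [z zD /interior_subset] := DX x Logic.I; rewrite ballEmdist => zx.
have zi : (index z (finmap.enum_fset D) < size (finmap.enum_fset D))%N.
  by rewrite index_mem.
by exists (Ordinal zi); rewrite /= nth_index.
Qed.

End TruncatedDistance.

(** * Integrals under the induced maps and weak* open sets *)

Lemma continuous_measurable_borel (X : ptopologicalType) (f : X -> X) :
  continuous f -> measurable_fun [set: borel X] (f : borel X -> borel X).
Proof.
move=> cf; apply: (@measurability _ _ (borel X) (borel X) setT f (@open X)) => // _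
  [A oA <-].
by rewrite setTI; apply: sub_sigma_algebra; exact: open_comp.
Qed.

Lemma continuous_measurable_real (R : realType) (X : ptopologicalType) (g : X -> R) :
  continuous g -> measurable_fun [set: borel X] (g : borel X -> R).
Proof.
move=> cg; apply: (measurability _ (RGenOpens.measurableE R)) => _ [_ [a [b ->]] <-].
by rewrite setTI; apply: sub_sigma_algebra; apply: open_comp.
Qed.

Lemma continuous_measurable_EFin (R : realType) (X : ptopologicalType) (g : X -> R) :
  continuous g -> measurable_fun [set: borel X] (fun x : borel X => (g x)%:E).
Proof. by move=> cg; apply/measurable_EFinP; exact: continuous_measurable_real. Qed.

Lemma integral_hat (R : realType) (X : ptopologicalType) (f : X -> X)
    (mu : Mspace R X) (g : X -> R) :
  continuous f -> continuous g -> (forall x, 0 <= g x) ->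
  (\int[(hat f mu : PM R X)]_x (g x)%:E = \int[(mu : PM R X)]_x (g (f x))%:E)%E.
Proof.
move=> cf cg g0; rewrite /hat; case: pselect => [mf|[]]; last first.
  exact: continuous_measurable_borel.
rewrite ge0_integral_distribution//.
exact: continuous_measurable_EFin.
Qed.

(** The outermost pushforward is absorbed into the test function, hence an induction over all
    [g]. *)
Lemma integral_compn_hatseq (R : realType) (X : ptopologicalType) (f : nat -> X -> X)
    (n : nat) (mu : Mspace R X) (g : X -> R) :
  (forall m, continuous (f m)) -> continuous g -> (forall x, 0 <= g x) ->
  (\int[(compn (hatseq f) n mu : PM R X)]_x (g x)%:E =
   \int[(mu : PM R X)]_x (g (compn f n x))%:E)%E.
Proof.
move=> cf; elim: n g => [//|n IHn] g cg g0 /=.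
rewrite integral_hat// (IHn (g \o f n))//= => x.
by apply: continuous_comp; [exact: cf|exact: cg].
Qed.

Lemma fine_integral_itv (R : realType) (X : ptopologicalType) (mu : PM R X)
    (g : X -> R) (D : R) : continuous g -> (forall t, 0 <= g t <= D) ->
  exists2 r : R, 0 <= r <= D & (\int[mu]_t (g t)%:E)%E = r%:E.
Proof.
move=> cg gD.
have mg : measurable_fun [set: borel X] (fun t => (g t)%:E).
  exact: continuous_measurable_EFin.
have i0 : (0 <= \int[mu]_t (g t)%:E)%E.
  by apply: integral_ge0 => t _; rewrite lee_fin; case/andP: (gD t).
have iD : (\int[mu]_t (g t)%:E <= D%:E)%E.
  rewrite -[leRHS]mule1 -(@probability_setT _ _ _ mu) -integral_cst//.
  apply: ge0_le_integral => //.
  - by move=> t _; rewrite lee_fin; case/andP: (gD t).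
  - by move=> t _; rewrite lee_fin; case/andP: (gD t).
have ifin : (\int[mu]_t (g t)%:E)%E \is a fin_num.
  by rewrite ge0_fin_numE// (le_lt_trans iD) ?ltry.
exists (fine (\int[mu]_t (g t)%:E)%E); last by rewrite fineK.
by rewrite -2!lee_fin fineK// i0 iD.
Qed.

(** Integration of [g] is the map inducing the topology followed by evaluation at [g]; finiteness of
    the integral makes [fine] harmless. *)
Lemma open_integral_itv (R : realType) (X : ptopologicalType) (g : X -> R) (D x y : R) :
  continuous g -> (forall t, 0 <= g t <= D) ->
  open [set mu : Mspace R X | x < fine (\int[(mu : PM R X)]_t (g t)%:E)%E < y].
Proof.
move=> cg gD; pose G : CX R X := exist _ g cg.
have cI : continuous (fun mu : Mspace R X => integrals (mu : PM R X) G).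
  move=> mu; apply: (@continuous_comp _ _ _ (@integrals R X : Mspace R X -> _)
    (fun h : {ptws CX R X -> \bar R} => h G)).
    exact: initial_continuous.
  (* [proj_continuous] wants an eqType of indices *)
  exact: (@proj_continuous {classic (CX R X)} (fun=> \bar R) G).
have -> : [set mu : Mspace R X | x < fine (\int[(mu : PM R X)]_t (g t)%:E)%E < y] =
    (fun mu : Mspace R X => integrals (mu : PM R X) G) @^-1`
      ([set z | (x%:E < z)%E] `&` [set z | (z < y%:E)%E]).
  apply/seteqP; split => mu /=; rewrite /integrals /=;
    have [r _ ->] := fine_integral_itv mu cg gD; rewrite /= !lte_fin.
    by move/andP.
  by case=> -> ->.
apply: open_comp => //; apply: openI.
  exact: open_ereal_gt_ereal.
exact: open_ereal_lt_ereal.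
Qed.

(** * Finitely supported probability measures and geometric weights *)

Section Atomic.
Variables (R : realType) (X : ptopologicalType) (k : nat).
Variable w : nat -> {nonneg R}.
Hypothesis w1 : \sum_(l < k) (w l)%:num = 1.
Variable p : nat -> X.

Definition atomic := msum (fun l => mscale (w l) (@dirac _ (borel X) (p l) R)) k.

HB.instance Definition _ := Measure.on atomic.

Let atomic_setT : atomic [set: borel X] = 1%E.
Proof.
rewrite /atomic /msum -w1 -sumEFin; apply: eq_bigr => l _.
by rewrite -[RHS]mule1; congr (_ * _)%E; exact: diracT.
Qed.

HB.instance Definition _ := Measure_isProbability.Build _ _ _ atomic atomic_setT.

Definition atomic_probability : PM R X := atomic.

Lemma integral_atomic (g : X -> R) : continuous g -> (forall x, 0 <= g x) ->
  (\int[atomic_probability]_x (g x)%:E = (\sum_(l < k) (w l)%:num * g (p l))%:E)%E.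
Proof.
move=> cg g0.
have mg : measurable_fun [set: borel X] (fun t => (g t)%:E).
  exact: continuous_measurable_EFin.
rewrite ge0_integral_measure_sum//; last by move=> x _; rewrite lee_fin.
rewrite -sumEFin; apply: eq_bigr => l _.
rewrite ge0_integral_mscale//; last by move=> x _; rewrite lee_fin.
by rewrite integral_dirac// diracT mul1e.
Qed.

End Atomic.

(* The terms below [i] add up to at most [D * 4^i / 3], the term [i] is at least
   [D * 4^i / 2]. *)
Lemma geometric_gap (R : realType) (c : nat -> R) (D : R) (k i : nat) :
  (forall l, `|c l| <= D) -> (i < k)%N -> D / 2 <= `|c i| ->
  (forall l, (i < l)%N -> (l < k)%N -> c l = 0) ->
  D / 6 <= `|\sum_(l < k) 4 ^+ l * c l|.
Proof.
move=> cD + ci; have D0 : 0 <= D := le_trans (normr_ge0 _) (cD 0%N).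
have low m : `|\sum_(l < m) 4 ^+ l * c l| <= D * ((4 ^+ m - 1) / 3).
  elim: m => [|m IHm]; first by rewrite big_ord0 normr0 expr0 subrr mul0r mulr0.
  rewrite big_ord_recr/= (le_trans (ler_normD _ _))//.
  have : `|4 ^+ m * c m| <= 4 ^+ m * D.
    by rewrite normrM ger0_norm ?exprn_ge0// ler_wpM2l ?exprn_ge0.
  rewrite exprS; lra.
(* Induction on [k] strips the vanishing terms above [i] until [i] is the top index. *)
elim: k => [//|k IHk] ik top; rewrite big_ord_recr/=.
move: ik; rewrite ltnS leq_eqVlt => /predU1P[<-|ik]; last first.
  rewrite (top k)// mulr0 addr0; apply: IHk => // l il lk.
  by apply: top => //; exact: leqW.
rewrite addrC; have : 4 ^+ i * (D / 2) <= `|4 ^+ i * c i|.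
  by rewrite normrM (ger0_norm (exprn_ge0 _ _))// ler_wpM2l ?exprn_ge0.
have := low i; have := lerB_normD (4 ^+ i * c i) (\sum_(l < i) 4 ^+ l * c l).
have : D * 1 <= D * 4 ^+ i by rewrite ler_wpM2l// exprn_ege1// ler1n.
lra.
Qed.

Lemma ln_card_words (R : realType) (n k : nat) :
  ln (#|{ffun 'I_k -> n.-tuple bool}|%:R : R) = k%:R * ln 2 * n%:R.
Proof.
rewrite card_ffun card_tuple card_bool card_ord -expnM natrX lnXn ?ltr0n//.
by rewrite -[_ *+ (n * k)]mulr_natl natrM; ring.
Qed.

(** * Entropy along [a] of the system and of its induced system *)

Section SeparatedEntropy.
Variables (R : realType) (X : pmetricType R) (f : nat -> X -> X).
Variables (delta : R) (a : nat -> nat).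
Hypothesis X_compact : compact [set: X].
Hypothesis f_continuous : forall n, continuous (f n).
Hypothesis delta_gt0 : 0 < delta.
Hypothesis a_words : forall n, exists x : n.-tuple bool -> X, forall s t, s != t ->
  exists i : 'I_n, delta < mdist (compn f (a i) (x s)) (compn f (a i) (x t)).

Lemma seq_entropy_ge_ln2 : ((ln 2 : R)%:E <= seq_entropy (R := R) f a)%E.
Proof.
have d4 : 0 < delta / 4 by rewrite divr_gt0.
have [J [z zP]] := compact_finite_net X_compact d4.
apply: (@seq_entropy_ge_separated _ _ _ _ J (fun j => tdist delta (z j))
  delta (delta / 2)).
- by rewrite divr_gt0.
- by move=> j x; rewrite tdist_ge0// tdist_le.
- move=> j x y; apply: (@open_comp _ _ (tdist delta (z j)) `]x, y[%classic).
    by move=> t _; exact: tdist_continuous.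
  exact: interval_open.
- move=> n _; have [x xP] := a_words n.
  exists (n.-tuple bool : finType), x; split.
    rewrite card_tuple card_bool natrX lnXn ?ltr0n//.
    by rewrite mulr_natr.
  move=> s t /xP[i id]; have [j jd] := tdist_separates zP id.
  by exists i, j.
Qed.

Lemma seq_entropy_hat_ge (k : nat) :
  ((k.+1%:R * ln 2 : R)%:E <= seq_entropy (R := R) (@hatseq R X f) a)%E.
Proof.
have d4 : 0 < delta / 4 by rewrite divr_gt0.
have [J [z zP]] := compact_finite_net X_compact d4.
pose W : R := \sum_(l < k.+1) 4 ^+ l.
have W0 : 0 < W.
  rewrite /W big_ord_recl expr0 ltr_pwDl//; apply: sumr_ge0 => l _.
  exact: exprn_ge0.
have w_ge0 l : 0 <= 4 ^+ l / W by rewrite divr_ge0 ?exprn_ge0 ?(ltW W0).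
pose w l : {nonneg R} := NngNum (w_ge0 l).
have w1 : \sum_(l < k.+1) (w l)%:num = 1.
  by rewrite /= -mulr_suml divff// gt_eqF.
pose phi j (mu : Mspace R X) : R :=
  fine (\int[(mu : PM R X)]_x (tdist delta (z j) x)%:E)%E.
have phiE n j (p : nat -> X) :
    phi j (compn (@hatseq R X f) n (atomic_probability w1 p)) =
    \sum_(l < k.+1) 4 ^+ l * tdist delta (z j) (compn f n (p l)) / W.
  rewrite /phi integral_compn_hatseq//.
  - rewrite integral_atomic/=.
    + by apply: eq_bigr => l _; rewrite mulrAC.
    + move=> x; apply: continuous_comp; first exact: compn_continuous.
      exact: tdist_continuous.
    + by move=> x; exact: tdist_ge0.
  - exact: tdist_continuous.
  - by move=> x; exact: tdist_ge0.
have tdistD j x : 0 <= tdist delta (z j) x <= delta.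
  by rewrite tdist_ge0// tdist_le.
(* The gap [delta / 6] comes from [geometric_gap] with [D = delta]; dividing by [W] accounts for the
   normalisation of the weights. *)
apply: (@seq_entropy_ge_separated _ _ _ _ J phi delta (delta / 6 / W)).
- by rewrite !divr_gt0.
- move=> j mu; rewrite /phi.
  by have [r rD ->] := fine_integral_itv mu (@tdist_continuous _ _ delta _) (tdistD j).
- move=> j x y; apply: (@open_integral_itv _ _ _ delta) => //.
  exact: tdist_continuous.
- move=> n _; have [x xP] := a_words n.
  exists ({ffun 'I_k.+1 -> n.-tuple bool} : finType).
  exists (fun s : {ffun 'I_k.+1 -> n.-tuple bool} =>
    atomic_probability w1 (fun l => x (s (inord l)))).
  split; first by rewrite ln_card_words.
  move=> s t st.
  have [i0 i0P] : exists i0, s i0 != t i0.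
    by apply/existsP; apply: contraNT st => /existsPn st;
      apply/eqP/ffunP => i; apply/eqP/negPn.
  case: (@arg_maxnP _ i0 (fun i => s i != t i) val i0P) => i iP imax.
  (* The time [m] and the net point [j] are chosen for the atom [i] alone; the lower atoms are
     merely bounded by [delta]. *)
  have [m md] := xP _ _ iP; have [j jd] := tdist_separates zP md.
  exists m, j; rewrite !phiE -sumrB.
  pose c l := tdist delta (z j) (compn f (a m) (x (s (inord l)))) -
              tdist delta (z j) (compn f (a m) (x (t (inord l)))).
  rewrite (eq_bigr (fun l : 'I_k.+1 => 4 ^+ l * c l / W)); last first.
    by move=> l _; rewrite /c mulrBr mulrBl.
  rewrite -mulr_suml normrM [`|W^-1|]gtr0_norm ?invr_gt0// ler_pM2r ?invr_gt0//.
  apply: (@geometric_gap _ c _ k.+1 i) => //.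
  + move=> l; rewrite /c; have /andP[? ?] := tdistD j (compn f (a m) (x (s (inord l)))).
    have /andP[? ?] := tdistD j (compn f (a m) (x (t (inord l)))).
    by rewrite ler_norml; apply/andP; split; lra.
  + by rewrite /c inord_val.
  + move=> l il lk; rewrite /c (_ : s (inord l) = t (inord l)) ?subrr//.
    by apply/eqP/negPn/negP => /imax; rewrite /= inordK// leqNgt il.
Qed.

Lemma seq_entropy_hat_pinfty : seq_entropy (R := R) (@hatseq R X f) a = +oo%E.
Proof.
apply: eq_infty => r; have ln2 : 0 < ln 2 :> R by rewrite ln_gt0// ltr1n.
apply: le_trans (seq_entropy_hat_ge (Num.truncn (r / ln 2))).
by rewrite lee_fin -ler_pdivrMr// ltW// truncnS_gt.
Qed.

End SeparatedEntropy.

Theorem theorem6p1 (R : realType) (X : pmetricType R) (f : nat -> X -> X) :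
  compact [set: X] ->
  (forall n, continuous (f n)) ->
  (forall y : X, exists x : X, f 0%N x = y) ->
  multi_sensitive f ->
  exists a : nat -> nat, strictly_increasing a /\
    (seq_entropy (R := R) f a <= hstar (R := R) f)%E /\
    ((ln 2 : R)%:E <= seq_entropy (R := R) f a)%E /\
    seq_entropy (R := R) (@hatseq R X f) a = +oo%E /\
    hstar (R := R) (@hatseq R X f) = +oo%E.
Proof.
move=> cX cf _ /multi_sensitive_finType[delta delta0 sens].
have [a [a_incr a_words]] :=
  separated_words (fun n => @compn_continuous _ f n cf) delta0 sens.
have hat_oo := seq_entropy_hat_pinfty cX cf delta0 a_words.
exists a; split=> //; split; first by apply: ereal_sup_ubound; exists a.
split; first exact: (seq_entropy_ge_ln2 cX delta0 a_words).
split=> //; apply/eqP; rewrite -leye_eq -hat_oo.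
by apply: ereal_sup_ubound; exists a.
Qed.
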